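(* Let $(G,S)$ and $(H,R)$ be rooted graphs. Then the unfolding trees $\mathcal{T}(G,S)$ and $\mathcal{T}(H,R)$ are isomorphic if and only if there exist non-edge-collapsing equivalence relations $\sim_G$ on $G$ and $\sim_H$ on $H$ such that $(G/\sim_G,[S]_{\sim_G})$ and $(H/\sim_H,[R]_{\sim_H})$ are rooted-isomorphic.
   Context: A graph is a tuple $G=(V,E,o,t)$ where $V$ (vertices) and $E$ (edges) are sets and $o,t:E\to V$ give the origin and terminus of each edge (loops and multiple edges allowed). A homomorphism $\phi:G\to G'$ is a pair of maps $\phi_V:V\to V'$, $\phi_E:E\to E'$ with $o'(\phi_E(e))=\phi_V(o(e))$ and $t'(\phi_E(e))=\phi_V(t(e))$; it is an isomorphism if both maps are bijections. A walk is either an empty walk $\epsilon_v$ ($v\in V$), with $O(\epsilon_v)=T(\epsilon_v)=v$, or a finite sequence $e_1\dots e_n$ ($n\ge1$) of edges with $t(e_i)=o(e_{i+1})$ for $1\le i<n$, with $O=o(e_1)$, $T=t(e_n)$. A root of $G$ is a vertex $S$ such that every vertex is the terminus of some walk with origin $S$; a rooted graph is a pair $(G,S)$ with $S$ a root of $G$. Rooted graphs $(G,S)$, $(H,R)$ are rooted-isomorphic if there is an isomorphism $G\to H$ sending $S$ to $R$. The unfolding tree $\mathcal{T}(G,S)$ has as vertices the walks with origin $S$, and for each such walk $w$ and each edge $e$ such that $we$ is a walk, an edge $(w,we)$ from $w$ to $we$; its root is $\epsilon_S$. An equivalence relation $\sim$ on a graph $G$ is a pair of equivalence relations $\sim_V$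 on $V$ and $\sim_E$ on $E$ such that $e_1\sim_E e_2$ implies $o(e_1)\sim_V o(e_2)$ and $t(e_1)\sim_V t(e_2)$. The quotient $G/\sim$ has vertex set $V/\sim_V$, edge set $E/\sim_E$, $o([e])=[o(e)]$, $t([e])=[t(e)]$. The relation $\sim$ is non-edge-collapsing if for all $v\sim_V v'$ and every edge $e$ with $o(e)=v$ there is exactly one edge $e'$ with $o(e')=v'$ and $e\sim_E e'$. *)

(* Defs.v *)
From Stdlib Require Import List RelationClasses Relation_Definitions FinFun.
From Stdlib Require Import FunctionalExtensionality PropExtensionality
  ProofIrrelevance.
Import ListNotations.

Set Implicit Arguments.
Unset Strict Implicit.

Record graph : Type := Graph {
  vertex : Type;
  edge : Type;
  o : edge -> vertex;
  t : edge -> vertex }.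

Record hom (G G' : graph) : Type := Hom {
  homV : vertex G -> vertex G';
  homE : edge G -> edge G';
  hom_o : forall e, o (homE e) = homV (o e);
  hom_t : forall e, t (homE e) = homV (t e) }.

Definition is_iso (G G' : graph) (f : hom G G') : Prop :=
  Bijective (homV f) /\ Bijective (homE f).

Definition isomorphic (G G' : graph) : Prop :=
  exists f : hom G G', is_iso f.

(* A walk is encoded by its origin [v] together with its list of edges [w].
   The empty walk at [v] is [(v, [])]; when [w] is nonempty, [is_walk v w]
   forces [v] to be the origin of its first edge. *)
Fixpoint is_walk (G : graph) (v : vertex G) (w : list (edge G)) : Prop :=
  match w with
  | [] => True
  | e :: w' => o e = v /\ is_walk (t e) w'
  end.

Fixpoint terminus (G : graph) (v : vertex G) (w : list (edge G)) : vertex G :=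
  match w with
  | [] => v
  | e :: w' => terminus (t e) w'
  end.

Definition is_root (G : graph) (S : vertex G) : Prop :=
  forall v, exists w, is_walk S w /\ terminus S w = v.

Record rooted_graph : Type := RootedGraph {
  rgraph :> graph;
  root : vertex rgraph;
  rootP : is_root root }.

Definition rooted_isomorphic (G H : rooted_graph) : Prop :=
  exists f : hom G H, is_iso f /\ homV f (root G) = root H.

Definition walk_at (G : graph) (S : vertex G) : Type :=
  {w : list (edge G) | is_walk S w}.

(* The edges are literally the pairs [(w, we)]. *)
Definition unfolding_graph (G : graph) (S : vertex G) : graph :=
  {| vertex := walk_at S;
     edge := {p : walk_at S * walk_at S |
               exists e, proj1_sig (snd p) = proj1_sig (fst p) ++ [e]};
     o := fun p => fst (proj1_sig p);
     t := fun p => snd (proj1_sig p) |}.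

Definition empty_walk (G : graph) (S : vertex G) : vertex (unfolding_graph S) :=
  exist _ [] I.

Lemma is_walk_app (G : graph) (v : vertex G) (w w' : list (edge G)) :
  is_walk v (w ++ w') <-> is_walk v w /\ is_walk (terminus v w) w'.
Proof. revert v; induction w as [|e w IH]; simpl; intros v; [|rewrite IH]; tauto. Qed.

Lemma terminus_app (G : graph) (v : vertex G) (w w' : list (edge G)) :
  terminus v (w ++ w') = terminus (terminus v w) w'.
Proof. revert v; induction w as [|e w IH]; simpl; auto. Qed.

Lemma empty_walk_root (G : graph) (S : vertex G) : is_root (empty_walk S).
Proof.
  intros [w Hw]; induction w as [|e w IH] using rev_ind.
  - exists []; split; [exact I|]; now apply subset_eq_compat.
  - destruct (proj1 (is_walk_app _ _ _) Hw) as [Hw1 _].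
    destruct (IH Hw1) as [p [Hp Tp]].
    set (a := exist _ w Hw1 : walk_at S) in *.
    set (b := exist _ (w ++ [e]) Hw : walk_at S).
    assert (Hab : exists e', proj1_sig (snd (a, b)) = proj1_sig (fst (a, b)) ++ [e'])
      by now exists e.
    exists (p ++ [exist _ (a, b) Hab : edge (unfolding_graph S)]).
    rewrite is_walk_app, terminus_app, Tp; simpl; auto.
Qed.

Definition unfolding_tree (G : rooted_graph) : rooted_graph :=
  RootedGraph (@empty_walk_root G (root G)).

Definition quot (A : Type) (R : relation A) : Type :=
  {C : A -> Prop | exists a, C = R a}.

Definition class (A : Type) (R : relation A) (a : A) : quot R :=
  exist _ (R a) (ex_intro _ a eq_refl).

Lemma quot_map_subproof (A B : Type) (RA : relation A) (RB : relation B)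
    (f : A -> B) (EA : Equivalence RA) (EB : Equivalence RB)
    (fR : forall a a', RA a a' -> RB (f a) (f a')) (a : A) :
  (fun b => exists a', RA a a' /\ RB (f a') b) = RB (f a).
Proof.
  apply functional_extensionality; intros b; apply propositional_extensionality.
  split.
  - intros [a' [Ha Hb]]; etransitivity; [apply fR; exact Ha | exact Hb].
  - intros Hb; exists a; split; [reflexivity | exact Hb].
Qed.

(* The map [[a] |-> [f a]], without choosing a representative: a class [C] is
   sent to the union of the classes of the [f a] for [a] in [C], which is a
   single class since [f] is compatible with the relations (see [quot_mapE]). *)
Definition quot_map (A B : Type) (RA : relation A) (RB : relation B)
    (f : A -> B) (EA : Equivalence RA) (EB : Equivalence RB)
    (fR : forall a a', RA a a' -> RB (f a) (f a')) (C : quot RA) : quot RB :=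
  exist _ (fun b => exists a, proj1_sig C a /\ RB (f a) b)
    (match proj2_sig C with
     | ex_intro _ a Ca =>
         ex_intro _ (f a)
           (eq_ind_r (fun D => (fun b => exists a', D a' /\ RB (f a') b) = RB (f a))
              (quot_map_subproof EA EB fR a) Ca)
     end).

Lemma quot_mapE (A B : Type) (RA : relation A) (RB : relation B)
    (f : A -> B) (EA : Equivalence RA) (EB : Equivalence RB)
    (fR : forall a a', RA a a' -> RB (f a) (f a')) (a : A) :
  quot_map EA EB fR (class RA a) = class RB (f a).
Proof. apply subset_eq_compat; exact (quot_map_subproof EA EB fR a). Qed.

Lemma class_surj (A : Type) (R : relation A) (C : quot R) :
  exists a, C = class R a.
Proof. destruct C as [C [a Ca]]; exists a; now apply subset_eq_compat. Qed.

Lemma class_eq (A : Type) (R : relation A) (ER : Equivalence R) (a b : A) :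
  class R a = class R b <-> R a b.
Proof.
  split.
  - intros H; apply (f_equal (@proj1_sig _ _)) in H; simpl in H.
    rewrite H; reflexivity.
  - intros H; apply subset_eq_compat; apply functional_extensionality; intros c.
    apply propositional_extensionality; split; intros Hc.
    + etransitivity; [symmetry; exact H | exact Hc].
    + etransitivity; [exact H | exact Hc].
Qed.

Record graph_equiv (G : graph) : Type := GraphEquiv {
  eqV : relation (vertex G);
  eqE : relation (edge G);
  eqV_equiv : Equivalence eqV;
  eqE_equiv : Equivalence eqE;
  eqE_o : forall e1 e2, eqE e1 e2 -> eqV (o e1) (o e2);
  eqE_t : forall e1 e2, eqE e1 e2 -> eqV (t e1) (t e2) }.

Definition non_edge_collapsing (G : graph) (r : graph_equiv G) : Prop :=
  forall v v', eqV r v v' ->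
  forall e, o e = v -> exists! e', o e' = v' /\ eqE r e e'.

Definition quotient_graph (G : graph) (r : graph_equiv G) : graph :=
  {| vertex := quot (eqV r);
     edge := quot (eqE r);
     o := quot_map (eqE_equiv r) (eqV_equiv r) (@eqE_o G r);
     t := quot_map (eqE_equiv r) (eqV_equiv r) (@eqE_t G r) |}.

Definition proj (G : graph) (r : graph_equiv G) : hom G (quotient_graph r) :=
  @Hom G (quotient_graph r) (class (eqV r)) (class (eqE r))
    (quot_mapE (eqE_equiv r) (eqV_equiv r) (@eqE_o G r))
    (quot_mapE (eqE_equiv r) (eqV_equiv r) (@eqE_t G r)).

Lemma hom_walk (G G' : graph) (f : hom G G') (w : list (edge G)) (v : vertex G) :
  is_walk v w ->
  is_walk (homV f v) (map (homE f) w) /\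
  terminus (homV f v) (map (homE f) w) = homV f (terminus v w).
Proof.
  revert v; induction w as [|e w IH]; simpl; intros v; [auto|].
  intros [He Hw]; rewrite hom_o, hom_t, He.
  now destruct (IH _ Hw).
Qed.

Lemma quotient_root (G : rooted_graph) (r : graph_equiv G) :
  is_root (homV (proj r) (root G)).
Proof.
  intros C; destruct (class_surj C) as [v ->].
  destruct (rootP v) as [w [Hw Tw]].
  destruct (hom_walk (proj r) Hw) as [Hw' Tw'].
  exists (map (homE (proj r)) w); split; [exact Hw'|].
  now rewrite Tw', Tw.
Qed.

Definition quotient (G : rooted_graph) (r : graph_equiv G) : rooted_graph :=
  @RootedGraph (quotient_graph r) (class (eqV r) (root G)) (@quotient_root G r).

(* Main.v *)
(** Call a homomorphism a covering when it restricts to a bijection between the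
    edges leaving [v] and those leaving the image of [v]. Walks lift uniquely
    along coverings, so coverings preserve unfolding trees, and the projection
    to a quotient is a covering exactly when the relation is
    non-edge-collapsing. Hence both sides of the theorem amount to the existence
    of coverings [G -> Q <- H] that agree on the roots. To get [Q] from an
    isomorphism of the trees, identify the termini of corresponding walks; the
    equivalence relation generated on the disjoint union of [G] and [H] matches
    the edges leaving equivalent vertices, and transporting these edges to a
    chosen representative of each class makes them the edges of [Q]. *)

From Stdlib Require Import List Relation_Definitions Relation_Operators FinFun.
From Stdlib Require Import RelationClasses ClassicalEpsilon ProofIrrelevance.
From Stdlib Require Import FunctionalExtensionality PropExtensionality.
Require Import Defs.
Import ListNotations.

Set Implicit Arguments.
Unset Strict Implicit.

(** * Coverings and isomorphisms of graphs *)

Definition covering (G Q : graph) (f : hom G Q) : Prop :=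
  forall v d, o d = homV f v -> exists! e, o e = v /\ homE f e = d.

Definition comp_hom (G H K : graph) (g : hom H K) (f : hom G H) : hom G K.
Proof.
  refine (@Hom G K (fun v => homV g (homV f v)) (fun e => homE g (homE f e)) _ _);
    intros e; [now rewrite !hom_o | now rewrite !hom_t].
Defined.

Lemma covering_comp (G H K : graph) (g : hom H K) (f : hom G H) :
  covering g -> covering f -> covering (comp_hom g f).
Proof.
  intros Cg Cf v d Hd.
  destruct (Cg _ _ Hd) as [d' [[Hd' <-] Ud']].
  destruct (Cf _ _ Hd') as [e [[He <-] Ue]].
  exists e; split; [now split|].
  intros e1 [He1 E1]; apply Ue; split; [exact He1|].
  symmetry; apply Ud'; split; [now rewrite hom_o, He1 | exact E1].
Qed.

(** [Bijective] asks for a two-sided inverse function; description picks the preimages that define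
    it. *)
Lemma bijective_of_inj_surj (A B : Type) (f : A -> B) :
  Injective f -> Surjective f -> Bijective f.
Proof.
  intros If Sf.
  exists (fun b => proj1_sig (constructive_indefinite_description _ (Sf b))).
  split.
  - intros a; destruct constructive_indefinite_description as [a' Ha']; simpl.
    now apply If.
  - intros b; now destruct constructive_indefinite_description as [a' Ha'].
Qed.

Lemma bijective_inj (A B : Type) (f : A -> B) : Bijective f -> Injective f.
Proof. intros [g [gf _]] x y E; now rewrite <- (gf x), E, gf. Qed.

Lemma bijective_surj (A B : Type) (f : A -> B) : Bijective f -> Surjective f.
Proof. intros [g [_ fg]] y; now exists (g y). Qed.

Lemma iso_covering (G H : graph) (f : hom G H) : is_iso f -> covering f.
Proof.
  intros [BV BE] v d Hd.
  destruct (bijective_surj BE d) as [e <-].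
  exists e; split; [split; [|reflexivity]|].
  - apply (bijective_inj BV); now rewrite <- hom_o.
  - intros e' [_ E]; now apply (bijective_inj BE).
Qed.

Lemma isomorphic_sym (G H : graph) : isomorphic G H -> isomorphic H G.
Proof.
  intros [f [[gV [VK KV]] [gE [EK KE]]]].
  unshelve eexists (@Hom H G gV gE _ _).
  - intros e; now rewrite <- (VK (o (gE e))), <- hom_o, KE.
  - intros e; now rewrite <- (VK (t (gE e))), <- hom_t, KE.
  - split; [now exists (homV f) | now exists (homE f)].
Qed.

Lemma isomorphic_trans (G H K : graph) :
  isomorphic G H -> isomorphic H K -> isomorphic G K.
Proof.
  intros [f [[fV [? ?]] [fE [? ?]]]] [g [[gV [? ?]] [gE [? ?]]]].
  exists (comp_hom g f); split.
  - exists (fun v => fV (gV v)); split; intros; simpl; congruence.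
  - exists (fun e => fE (gE e)); split; intros; simpl; congruence.
Qed.

(** * Vertices and edges of unfolding trees *)

Section Unfolding.
Variables (G : graph) (S : vertex G).

Lemma walk_at_ext (a b : walk_at S) : proj1_sig a = proj1_sig b -> a = b.
Proof. destruct a, b; simpl; intros E; now apply subset_eq_compat. Qed.

Lemma unfolding_edge_ext (p q : edge (unfolding_graph S)) :
  o p = o q -> t p = t q -> p = q.
Proof.
  destruct p as [[a b] Hp], q as [[c d] Hq]; simpl; intros -> ->.
  now apply subset_eq_compat.
Qed.

Lemma unfolding_edge_step (p : edge (unfolding_graph S)) :
  exists e, proj1_sig (t p) = proj1_sig (o p) ++ [e].
Proof. exact (proj2_sig p). Qed.

Lemma unfolding_edge_from (a : walk_at S) (e : edge G) :
  o e = terminus S (proj1_sig a) ->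
  exists p : edge (unfolding_graph S),
    o p = a /\ proj1_sig (t p) = proj1_sig a ++ [e].
Proof.
  intros He.
  assert (W : is_walk S (proj1_sig a ++ [e])).
  { apply is_walk_app; split; [exact (proj2_sig a) | now split]. }
  assert (P : exists e', proj1_sig (snd (a, exist _ _ W : walk_at S)) =
                         proj1_sig (fst (a, exist _ _ W : walk_at S)) ++ [e'])
    by now exists e.
  now exists (exist _ (a, exist _ _ W) P).
Qed.

Lemma walk_at_snoc (a b : walk_at S) (e : edge G) :
  proj1_sig b = proj1_sig a ++ [e] ->
  o e = terminus S (proj1_sig a) /\ t e = terminus S (proj1_sig b).
Proof.
  intros E; rewrite E, terminus_app; simpl; split; [|reflexivity].
  pose proof (proj2_sig b) as W; rewrite E in W.
  apply is_walk_app in W; apply W.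
Qed.

End Unfolding.

(** * Lifting walks along a covering *)

Section CoveringUnfolding.
Variables (G Q : graph) (f : hom G Q).
Hypothesis Cf : covering f.

Lemma lift_walk (v : vertex G) (w' : list (edge Q)) :
  is_walk (homV f v) w' -> exists w, is_walk v w /\ map (homE f) w = w'.
Proof.
  revert v; induction w' as [|d w' IH]; simpl; intros v; [now exists []|].
  intros [Hd Hw']; destruct (Cf Hd) as [e [[He <-] _]].
  rewrite hom_t in Hw'; destruct (IH _ Hw') as [w [Hw <-]].
  now exists (e :: w).
Qed.

Lemma lift_walk_unique (v : vertex G) (w1 w2 : list (edge G)) :
  is_walk v w1 -> is_walk v w2 -> map (homE f) w1 = map (homE f) w2 -> w1 = w2.
Proof.
  revert v w2; induction w1 as [|e1 w1 IH]; intros v [|e2 w2]; simpl;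
    try discriminate; [auto|].
  intros [H1 W1] [H2 W2] E; injection E as Ee Ew.
  assert (Hd : o (homE f e1) = homV f v) by now rewrite hom_o, H1.
  destruct (Cf Hd) as [e [_ Ue]].
  assert (e1 = e2) as <-.
  { rewrite <- (Ue e1), <- (Ue e2); auto. }
  f_equal; exact (IH _ _ W1 W2 Ew).
Qed.

Variable S : vertex G.

Definition map_walk (a : walk_at S) : walk_at (homV f S) :=
  exist _ (map (homE f) (proj1_sig a)) (proj1 (hom_walk f (proj2_sig a))).

Lemma map_walk_step (p : edge (unfolding_graph S)) :
  exists d, proj1_sig (map_walk (t p)) = proj1_sig (map_walk (o p)) ++ [d].
Proof.
  destruct (unfolding_edge_step p) as [e E].
  exists (homE f e); simpl in *; now rewrite E, map_app.
Qed.

Definition unfolding_hom :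
    hom (unfolding_graph S) (unfolding_graph (homV f S)) :=
  @Hom (unfolding_graph S) (unfolding_graph (homV f S)) map_walk
    (fun p => exist _ (map_walk (o p), map_walk (t p)) (map_walk_step p))
    (fun p => eq_refl) (fun p => eq_refl).

(** Existence of lifts makes [map_walk] surjective and uniqueness makes it injective. The edges
    follow because a tree edge is determined by its two ends. *)
Lemma covering_unfolding :
  isomorphic (unfolding_graph S) (unfolding_graph (homV f S)).
Proof.
  assert (IV : Injective map_walk).
  { intros a b E; apply walk_at_ext.
    apply (f_equal (@proj1_sig _ _)) in E.
    exact (lift_walk_unique (proj2_sig a) (proj2_sig b) E). }
  assert (SV : Surjective map_walk).
  { intros [w' W']; destruct (lift_walk W') as [w [W E]].
    exists (exist _ w W); now apply walk_at_ext. }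
  exists unfolding_hom; split; apply bijective_of_inj_surj; auto.
  - intros p q E; apply unfolding_edge_ext; apply IV.
    + exact (f_equal (@o (unfolding_graph (homV f S))) E).
    + exact (f_equal (@t (unfolding_graph (homV f S))) E).
  - intros q.
    (* Lift the source of [q] to a walk [a], then lift the last edge [d] of its target at the
       terminus of [a]. *)
    destruct (SV (o q)) as [a Ea], (unfolding_edge_step q) as [d Ed].
    destruct (walk_at_snoc Ed) as [Hd _].
    rewrite <- Ea in Hd; simpl in Hd.
    rewrite (proj2 (hom_walk f (proj2_sig a))) in Hd.
    destruct (Cf Hd) as [e [[He <-] _]].
    destruct (unfolding_edge_from He) as [p [Op Tp]].
    exists p; apply unfolding_edge_ext.
    + rewrite <- Ea, <- Op; reflexivity.
    + apply walk_at_ext; rewrite Ed, <- Ea; simpl in *.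
      now rewrite Tp, map_app.
Qed.

End CoveringUnfolding.

(** * Coverings and non-edge-collapsing relations *)

Lemma covering_proj (G : graph) (r : graph_equiv G) :
  non_edge_collapsing r -> covering (proj r).
Proof.
  intros N v D HD; destruct (class_surj D) as [e ->].
  (* The representative [e] starts only at a vertex equivalent to [v]; non-edge-collapsing moves it
     to a unique edge at [v] itself. *)
  assert (He : eqV r (o e) v).
  { apply (class_eq (eqV_equiv r)).
    exact (eq_trans (eq_sym (hom_o (proj r) e)) HD). }
  destruct (N _ _ He e eq_refl) as [e' [[He' Ee'] Ue']].
  exists e'; split.
  - split; [exact He'|].
    apply (class_eq (eqE_equiv r)), (@Equivalence_Symmetric _ _ (eqE_equiv r)), Ee'.
  - intros e1 [He1 E1]; apply Ue'; split; [exact He1|].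
    now apply (class_eq (eqE_equiv r)).
Qed.

Lemma kernel_equivalence (A B : Type) (f : A -> B) :
  Equivalence (fun x y => f x = f y).
Proof. split; congruence. Qed.

Definition kernel (G Q : graph) (f : hom G Q) : graph_equiv G.
Proof.
  refine (@GraphEquiv G _ _ (kernel_equivalence (homV f))
            (kernel_equivalence (homE f)) _ _); intros e1 e2 E.
  - now rewrite <- !hom_o, E.
  - now rewrite <- !hom_t, E.
Defined.

Lemma kernel_non_edge_collapsing (G Q : graph) (f : hom G Q) :
  covering f -> non_edge_collapsing (kernel f).
Proof.
  intros Cf v v' Hv e He; simpl in *.
  assert (Hd : o (homE f e) = homV f v') by now rewrite hom_o, He.
  destruct (Cf _ _ Hd) as [e' [[He' E'] U]].
  exists e'; split; [now split|].
  intros e1 [H1 E1]; now apply U.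
Qed.

(** * Coverings that agree on the roots have the same image *)

Section SameImage.
Variables (Q : graph) (G H : rooted_graph) (f : hom G Q) (h : hom H Q).
Hypotheses (Ch : covering h) (fh : homV f (root G) = homV h (root H)).

(** Push a walk from the root to [v] down to [Q] and lift it along [h] from the root of [H]: the
    lift ends over the image of [v]. *)
Lemma image_vertex (v : vertex G) : exists u, homV f v = homV h u.
Proof.
  destruct (rootP v) as [w [W <-]].
  destruct (hom_walk f W) as [W' T']; rewrite fh in W', T'.
  destruct (lift_walk Ch W') as [w1 [W1 E1]].
  exists (terminus (root H) w1).
  now rewrite <- T', <- (proj2 (hom_walk h W1)), E1.
Qed.

Lemma image_edge (e : edge G) : exists d, homE f e = homE h d.
Proof.
  destruct (image_vertex (o e)) as [u Hu]; rewrite <- hom_o in Hu.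
  destruct (Ch Hu) as [d [[_ Ed] _]]; now exists d.
Qed.

End SameImage.

(** Each quotient is a copy of the image of its covering in [Q], and the two images coincide. *)
Lemma kernel_quotient_iso (Q : graph) (G H : rooted_graph)
    (f : hom G Q) (h : hom H Q) :
  covering f -> covering h -> homV f (root G) = homV h (root H) ->
  rooted_isomorphic (quotient (kernel f)) (quotient (kernel h)).
Proof.
  intros Cf Ch fh.
  assert (C : forall (A B X : Type) (a : A -> X) (b : B -> X),
             (forall x, exists y, a x = b y) -> exists g, forall x, a x = b (g x)).
  { intros A B X a b E.
    exists (fun x => proj1_sig (constructive_indefinite_description _ (E x))).
    intros x; now destruct constructive_indefinite_description. }
  (* The chosen maps need not be homomorphisms. Their values are determined up to the kernels, so
     they induce mutually inverse maps on classes. *)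
  destruct (C _ _ _ _ _ (image_vertex Ch fh)) as [gV HgV].
  destruct (C _ _ _ _ _ (image_edge Ch fh)) as [gE HgE].
  destruct (C _ _ _ _ _ (image_vertex Cf (eq_sym fh))) as [kV HkV].
  destruct (C _ _ _ _ _ (image_edge Cf (eq_sym fh))) as [kE HkE].
  assert (RgV : forall x y, eqV (kernel f) x y -> eqV (kernel h) (gV x) (gV y))
    by (simpl; congruence).
  assert (RgE : forall x y, eqE (kernel f) x y -> eqE (kernel h) (gE x) (gE y))
    by (simpl; congruence).
  assert (RkV : forall x y, eqV (kernel h) x y -> eqV (kernel f) (kV x) (kV y))
    by (simpl; congruence).
  assert (RkE : forall x y, eqE (kernel h) x y -> eqE (kernel f) (kE x) (kE y))
    by (simpl; congruence).
  pose (qV := quot_map (eqV_equiv _) (eqV_equiv _) RgV).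
  pose (qE := quot_map (eqE_equiv _) (eqE_equiv _) RgE).
  assert (Ho : forall D : edge (quotient (kernel f)),
             o (qE D : edge (quotient (kernel h))) = qV (o D)).
  { intros D; destruct (class_surj D) as [e ->]; unfold qE, qV; simpl.
    rewrite !quot_mapE; apply (class_eq (eqV_equiv (kernel h))); simpl.
    now rewrite <- HgV, <- !hom_o, <- HgE. }
  assert (Ht : forall D : edge (quotient (kernel f)),
             t (qE D : edge (quotient (kernel h))) = qV (t D)).
  { intros D; destruct (class_surj D) as [e ->]; unfold qE, qV; simpl.
    rewrite !quot_mapE; apply (class_eq (eqV_equiv (kernel h))); simpl.
    now rewrite <- HgV, <- !hom_t, <- HgE. }
  exists (@Hom (quotient (kernel f)) (quotient (kernel h)) qV qE Ho Ht).
  split; [split|].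
  - exists (quot_map (eqV_equiv _) (eqV_equiv _) RkV).
    split; intros D; destruct (class_surj D) as [v ->]; unfold qV; simpl;
      rewrite !quot_mapE; apply (class_eq (kernel_equivalence _)); simpl; congruence.
  - exists (quot_map (eqE_equiv _) (eqE_equiv _) RkE).
    split; intros D; destruct (class_surj D) as [e ->]; unfold qE; simpl;
      rewrite !quot_mapE; apply (class_eq (kernel_equivalence _)); simpl; congruence.
  - unfold qV; simpl; rewrite quot_mapE; apply (class_eq (kernel_equivalence _)); simpl.
    now rewrite <- HgV.
Qed.

(** * Merging vertices with matching outgoing edges *)

(** [M] is the graph of a bijection between outgoing edges. As a relation it can be reversed and
    composed without choice. *)
Record matching (K : graph) (R : relation (vertex K)) (u v : vertex K)
    (M : edge K -> edge K -> Prop) : Prop := Matching {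
  matching_o : forall d e, M d e -> o d = u /\ o e = v;
  matching_t : forall d e, M d e -> R (t d) (t e);
  matching_total : forall d, o d = u -> exists e, M d e;
  matching_surj : forall e, o e = v -> exists d, M d e;
  matching_fun : forall d e e', M d e -> M d e' -> e = e';
  matching_inj : forall d d' e, M d e -> M d' e -> d = d' }.

Section MergeVertices.
Variables (K : graph) (B : relation (vertex K)).
Hypothesis BM : forall u v, B u v -> exists M, matching B u v M.

(** The closure rules correspond to the identity, the converse and the composite of matchings; in
    the base case the relation on termini is weakened from [B] to its closure. *)
Lemma closure_matching (u v : vertex K) :
  clos_refl_sym_trans _ B u v ->
  exists M, matching (clos_refl_sym_trans _ B) u v M.
Proof.
  induction 1 as [u v Huv|u|u v _ [M IH]|u v w _ [M IM] _ [N IN]].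
  - destruct (BM Huv) as [M [HO HT HA HS HF HI]].
    exists M; split; auto; intros d e HM; now apply rst_step, HT.
  - exists (fun d e => o d = u /\ d = e); split.
    + intros d e [Hd <-]; auto.
    + intros d e [_ <-]; apply rst_refl.
    + now intros d Hd; exists d.
    + now intros d Hd; exists d.
    + intros d e e' [_ <-] [_ <-]; reflexivity.
    + intros d d' e [_ ->] [_ ->]; reflexivity.
  - destruct IH as [HO HT HA HS HF HI].
    exists (fun d e => M e d); split; eauto.
    + intros d e HM; destruct (HO _ _ HM); auto.
    + intros d e HM; now apply rst_sym, HT.
  - exists (fun d e => exists c, M d c /\ N c e); split.
    + intros d e [c [H1 H2]]; split; [apply (matching_o IM H1)|apply (matching_o IN H2)].
    + intros d e [c [H1 H2]]; eapply rst_trans;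
        [exact (matching_t IM H1)|exact (matching_t IN H2)].
    + intros d Hd; destruct (matching_total IM Hd) as [c Hc].
      destruct (matching_total IN (proj2 (matching_o IM Hc))) as [e He]; eauto.
    + intros e He; destruct (matching_surj IN He) as [c Hc].
      destruct (matching_surj IM (proj1 (matching_o IN Hc))) as [d Hd]; eauto.
    + intros d e e' [c [H1 H2]] [c' [H1' H2']].
      rewrite (matching_fun IM H1' H1) in H2'; exact (matching_fun IN H2 H2').
    + intros d d' e [c [H1 H2]] [c' [H1' H2']].
      rewrite (matching_inj IN H2' H2) in H1'; exact (matching_inj IM H1 H1').
Qed.

Lemma merge_covering :
  exists (Q : graph) (f : hom K Q),
    covering f /\ forall u v, B u v -> homV f u = homV f v.
Proof.
  set (E := clos_refl_sym_trans _ B).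
  pose (rep v := epsilon (inhabits v) (E v)).
  assert (Erep : forall v, E (rep v) v).
  { intros v; apply rst_sym; apply epsilon_spec; exists v; apply rst_refl. }
  assert (repE : forall u v, E u v -> rep u = rep v).
  { intros u v Huv; unfold rep.
    (* [epsilon] picks the same element for [u] and [v] once its inhabitation proofs and the
       predicates [E u] and [E v] are identified. *)
    rewrite (proof_irrelevance _ (inhabits u) (inhabits v)); f_equal.
    apply functional_extensionality; intros w; apply propositional_extensionality.
    split; intros Hw; [apply rst_trans with u; [now apply rst_sym|]|
                       apply rst_trans with v]; assumption. }
  assert (HM : forall v, {M | matching E (rep v) v M}).
  { intros v; apply constructive_indefinite_description, closure_matching, Erep. }
  (* Fixing one matching per vertex makes the map [c] below a bijection from the edges leaving [v]
     to those leaving [rep v]. *)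
  pose (M v := proj1_sig (HM v)).
  assert (MP : forall v, matching E (rep v) v (M v))
    by (intros v; exact (proj2_sig (HM v))).
  assert (Hc : forall e, {d | M (o e) d e}).
  { intros e; apply constructive_indefinite_description.
    exact (matching_surj (MP _) eq_refl). }
  pose (c e := proj1_sig (Hc e)).
  assert (cP : forall e, M (o e) (c e) e) by (intros e; exact (proj2_sig (Hc e))).
  (* Only termini are redirected, to representatives. Other vertices stay in [Q], but the covering
     condition concerns only edges leaving representatives. *)
  pose (Q := {| vertex := vertex K; edge := edge K;
                o := @o K; t := fun d => rep (t d) |}).
  unshelve eexists Q, (@Hom K Q rep c _ _).
  - intros e; exact (proj1 (matching_o (MP _) (cP e))).
  - intros e; apply repE; exact (matching_t (MP _) (cP e)).
  - split; [|intros u v Huv; apply repE; now apply rst_step].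
    intros v d Hd; simpl in *.
    destruct (matching_total (MP v) Hd) as [e He].
    destruct (matching_o (MP v) He) as [_ Oe].
    exists e; split.
    + split; [exact Oe|].
      pose proof (cP e) as Ce; rewrite Oe in Ce.
      exact (matching_inj (MP v) Ce He).
    + intros e' [Oe' <-].
      pose proof (cP e') as Ce; rewrite Oe' in Ce.
      exact (matching_fun (MP v) He Ce).
Qed.

End MergeVertices.

(** * From a tree isomorphism to a common covered graph *)

Definition disjoint_union (G H : graph) : graph :=
  {| vertex := vertex G + vertex H;
     edge := edge G + edge H;
     o := fun e => match e with inl e => inl (o e) | inr e => inr (o e) end;
     t := fun e => match e with inl e => inl (t e) | inr e => inr (t e) end |}.

Definition inl_hom (G H : graph) : hom G (disjoint_union G H) :=
  @Hom G (disjoint_union G H) inl inl (fun e => eq_refl) (fun e => eq_refl).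

Definition inr_hom (G H : graph) : hom H (disjoint_union G H) :=
  @Hom H (disjoint_union G H) inr inr (fun e => eq_refl) (fun e => eq_refl).

Lemma covering_inl (G H : graph) : covering (inl_hom G H).
Proof.
  intros v [e|e] He; simpl in *; [|discriminate].
  injection He as He; exists e; split; [now split|].
  intros e' [_ E]; now injection E.
Qed.

Lemma covering_inr (G H : graph) : covering (inr_hom G H).
Proof.
  intros v [e|e] He; simpl in *; [discriminate|].
  injection He as He; exists e; split; [now split|].
  intros e' [_ E]; now injection E.
Qed.

(* The root of an unfolding tree is its only vertex without incoming edge. *)
Lemma unfolding_iso_root (G H : graph) (S : vertex G) (R : vertex H)
    (f : hom (unfolding_graph S) (unfolding_graph R)) :
  is_iso f -> homV f (empty_walk S) = empty_walk R.
Proof.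
  intros [BV BE]; apply walk_at_ext.
  destruct (homV f (empty_walk S)) as [w W] eqn:Ew; simpl.
  induction w as [|e w _] using rev_ind; [reflexivity|exfalso].
  destruct (proj1 (is_walk_app _ _ _) W) as [W0 [He _]].
  destruct (@unfolding_edge_from H R (exist _ w W0) e He) as [q [_ Tq]].
  destruct (bijective_surj BE q) as [p <-].
  assert (Tp : t p = empty_walk S).
  { apply (bijective_inj BV); rewrite Ew, <- hom_t; now apply walk_at_ext. }
  destruct (unfolding_edge_step p) as [d Ed].
  rewrite Tp in Ed; simpl in Ed; now destruct (app_cons_not_nil _ _ _ Ed).
Qed.

Lemma unfolding_iso_coverings (G H : graph) (S : vertex G) (R : vertex H) :
  isomorphic (unfolding_graph S) (unfolding_graph R) ->
  exists (Q : graph) (f : hom G Q) (h : hom H Q),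
    covering f /\ covering h /\ homV f S = homV h R.
Proof.
  intros [phi Hphi]; pose proof (unfolding_iso_root Hphi) as Hroot.
  destruct Hphi as [BV BE].
  pose (B (x y : vertex (disjoint_union G H)) :=
    exists a : walk_at S, x = inl (terminus S (proj1_sig a)) /\
      y = inr (terminus R (proj1_sig (homV phi a)))).
  assert (BM : forall x y, B x y -> exists M, matching B x y M).
  { intros x y [a [-> ->]].
    (* An edge [e] leaving the terminus of [a] extends [a] along a tree edge [p]; its partner [e']
       is the edge by which [homE phi p] extends the image of [a]. The matching may depend on [a],
       and one per related pair suffices. *)
    exists (fun d d' => exists e e' (p : edge (unfolding_graph S)),
      d = inl e /\ d' = inr e' /\ o p = a /\
      proj1_sig (t p) = proj1_sig a ++ [e] /\
      proj1_sig (t (homE phi p)) = proj1_sig (homV phi a) ++ [e']).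
    split.
    - intros d d' (e & e' & p & -> & -> & Op & Tp & Tq); simpl.
      destruct (walk_at_snoc Tp) as [-> _]; destruct (walk_at_snoc Tq) as [-> _].
      auto.
    - intros d d' (e & e' & p & -> & -> & Op & Tp & Tq); simpl.
      exists (t p); rewrite <- hom_t.
      destruct (walk_at_snoc Tp) as [_ ->]; destruct (walk_at_snoc Tq) as [_ ->].
      auto.
    - intros [e|e] He; simpl in He; [injection He as He|discriminate].
      destruct (unfolding_edge_from He) as [p [Op Tp]].
      destruct (unfolding_edge_step (homE phi p)) as [e' E'].
      rewrite hom_o, Op in E'.
      exists (inr e'), e, e', p; auto.
    - intros [e|e'] He; simpl in He; [discriminate|injection He as He].
      destruct (unfolding_edge_from He) as [q [Oq Tq]].
      destruct (bijective_surj BE q) as [p <-].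
      assert (Op : o p = a) by (apply (bijective_inj BV); now rewrite <- hom_o).
      destruct (unfolding_edge_step p) as [e E]; rewrite Op in E.
      exists (inl e), e, e', p; auto.
    - intros d d1 d2 (e & e1 & p & -> & -> & Op & Tp & Tq)
        (e0 & e2 & p0 & E0 & -> & Op0 & Tp0 & Tq0).
      injection E0 as <-.
      assert (p = p0) as <-.
      { apply unfolding_edge_ext; [congruence|apply walk_at_ext; congruence]. }
      rewrite Tq in Tq0; apply app_inj_tail in Tq0; now destruct Tq0 as [_ ->].
    - intros d1 d2 d (e1 & e & p & -> & -> & Op & Tp & Tq)
        (e2 & e0 & p0 & -> & E0 & Op0 & Tp0 & Tq0).
      injection E0 as <-.
      (* The images of [p] and [p0] have the same source and extend it by the same edge, so they
         coincide. *)
      assert (p = p0) as <-.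
      { apply (bijective_inj BE), unfolding_edge_ext.
        - rewrite !hom_o; congruence.
        - apply walk_at_ext; congruence. }
      rewrite Tp in Tp0; apply app_inj_tail in Tp0; now destruct Tp0 as [_ ->]. }
  destruct (merge_covering BM) as (Q & f & Cf & Ef).
  exists Q, (comp_hom f (inl_hom G H)), (comp_hom f (inr_hom G H)).
  repeat split; [apply covering_comp; auto using covering_inl..|].
  - apply covering_inr.
  (* The empty walks correspond under [phi], so [B] relates the two roots. *)
  - apply Ef; exists (empty_walk S); now rewrite Hroot.
Qed.

Theorem theorem1 (G H : rooted_graph) :
  isomorphic (unfolding_tree G) (unfolding_tree H) <->
  exists (rG : graph_equiv G) (rH : graph_equiv H),
    non_edge_collapsing rG /\ non_edge_collapsing rH /\
    rooted_isomorphic (quotient rG) (quotient rH).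
Proof.
  split.
  - intros I; destruct (unfolding_iso_coverings I) as (Q & f & h & Cf & Ch & fh).
    exists (kernel f), (kernel h).
    auto using kernel_non_edge_collapsing, kernel_quotient_iso.
  - intros (rG & rH & NG & NH & phi & Iphi & Ephi).
    (* Both graphs cover the quotient of [H], with [G] going through its own quotient and [phi]. The
       roots have the same image, so both trees are isomorphic to the unfolding of that quotient. *)
    pose proof (covering_unfolding
      (covering_comp (iso_covering Iphi) (covering_proj NG)) (root G)) as IG.
    pose proof (covering_unfolding (covering_proj NH) (root H)) as IH.
    simpl in IG, IH, Ephi; rewrite Ephi in IG.
    exact (isomorphic_trans IG (isomorphic_sym IH)).
Qed.
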